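(* Let $\mathbb{P}$ be a partition of $\Omega$, let $\mathcal{E}$ be an arbitrary set of conditional events such that $C|D\neq\varnothing|D$ and $C|D\ne D|D$ for every $C|D\in\mathcal{E}$. If $\underline P$ is a W-coherent (respectively C-convex) lower probability on $\mathcal{A}_C(\mathbb{P})$, then its extension to $\mathcal{A}_C(\mathbb{P})\cup\mathcal{E}$ given by $\underline P(C|D)=\underline P((C|D)_* )$ for all $C|D\in\mathcal{E}$ is a W-coherent (respectively C-convex) lower probability. If $\overline P$ is a W-coherent (respectively C-convex) upper probability on $\mathcal{A}_C(\mathbb{P})$, then its extension to $\mathcal{A}_C(\mathbb{P})\cup\mathcal{E}$ given by $\overline P(C|D)=\overline P((C|D)^* )$ for all $C|D\in\mathcal{E}$ is a W-coherent (respectively C-convex) upper probability.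
   Context: Events are subsets of a nonempty set $\Omega$ (the sure event); $\wedge,\vee,\neg$ denote intersection, union, complement; $\Rightarrow$ denotes inclusion; an event is identified with its indicator function. A gamble is a bounded function $X:\Omega\to\mathbb{R}$. For an event $B\neq\varnothing$, the conditional gamble $X|B$ is the restriction of $X$ to $B$ (so two conditional gambles with the same $B$ and the same restriction are identified); $\sup(X|B)=\sup_{\omega\in B}X(\omega)$. A conditional event $A|B$ ($B\ne\varnothing$) is the conditional gamble $I_A|B$; in particular $A|B=A\wedge B|B$. Consistency notions, for a set $\mathcal{S}$ of conditional gambles. A map $\underline P:\mathcal{S}\to\mathbb{R}$ (lower prevision) is W-coherent iff for all $n\in\mathbb{N}$, all $X_0|B_0,\dots,X_n|B_n\in\mathcal{S}$ and all real $s_0,\dots,s_n\ge 0$, setting $B=\bigvee_{i=0}^n B_i$ and $\underline G=\sum_{i=1}^n s_iB_i(X_i-\underline P(X_i|B_i))-s_0B_0(X_0-\underline P(X_0|B_0))$, one has $\sup(\underline G|B)\ge 0$. It is convex iff the same condition is required only for stakes with $\sum_{i=1}^n s_i=s_0>0$; it is C-convex (centered convex) iff it is convex and $X|B\in\mathcal{S}$ implies $0|B\in\mathcal{S}$ and $\underline P(0|B)=0$. A map $\overline P:\mathcal{S}\to\mathbb{R}$ (upper prevision) is W-coherent, respectively C-convex, iff the lower prevision $-X|B\mapsto-\overline P(X|B)$ on $\{-X|B: X|B\in\mathcal{S}\}$ is. These are called (lower, upper) probabilities when all elements of $\mathcal{S}$ are conditional events. Convention for C-convexity of extensions: when the assessment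 is extended to events $C|D$, the events $\varnothing|D$ (i.e. $0|D$), if not already present, are understood to be adjoined to the domain with value $0$. A partition $\mathbb{P}$ is a set of pairwise disjoint nonempty events with union $\Omega$; $\mathcal{A}(\mathbb{P})$ is the set of all unions of elements of $\mathbb{P}$; $\mathcal{A}_C(\mathbb{P})=\{A|B: A,B\in\mathcal{A}(\mathbb{P}),\,B\ne\varnothing\}$. For an event $E$: $E_*=\bigvee_{e\in\mathbb{P}:\,e\Rightarrow E}e$ and $E^*=\bigvee_{e\in\mathbb{P}:\,e\wedge E\ne\varnothing}e$. For a conditional event $C|D$ with $C|D\neq\varnothing|D$, $C|D\ne D|D$: $(C|D)_*=(C\wedge D)_*\,|\,[(C\wedge D)_*\vee(\neg C\wedge D)^*]$ and $(C|D)^*=(C\wedge D)^*\,|\,[(C\wedge D)^*\vee(\neg C\wedge D)_*]$; both belong to $\mathcal{A}_C(\mathbb{P})$. *)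

(* Defs.v *)
From mathcomp Require Import all_boot all_order all_algebra.
From mathcomp Require Import all_classical all_reals all_analysis.

Set Implicit Arguments.
Unset Strict Implicit.
Unset Printing Implicit Defensive.

Import Order.TTheory GRing.Theory Num.Theory numFieldNormedType.Exports.

Local Open Scope classical_set_scope.
Local Open Scope ring_scope.

(* The restriction of a gamble X to B is represented by its extension by 0
   outside B, so that Leibniz equality of conditional gambles is equality of
   the conditioning events and of the restrictions (see [condgP]). *)
Record cgamble (Omega : Type) (R : realType) := CGamble {
  cg_fun :> Omega -> R;
  cg_cond : set Omega;
  cg_cond_neq0 : cg_cond !=set0;
  cg_bounded : bounded_fun cg_fun;
  cg_out : forall w, ~ cg_cond w -> cg_fun w = 0 }.

Section ConditionalGambles.
Context {Omega : Type} {R : realType}.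
Implicit Types (X Y : Omega -> R) (A B C D : set Omega).
Local Notation cgamble := (cgamble Omega R).

Lemma cgamble_eq (G H : cgamble) :
  cg_cond G = cg_cond H -> cg_fun G = cg_fun H -> G = H.
Proof.
case: G => f B p q r; case: H => g B' p' q' r' /= eB ef; subst B' g.
by congr CGamble; exact: Prop_irrelevance.
Qed.

Lemma bounded_indicM X B :
  bounded_fun X -> bounded_fun (fun w => \1_B w * X w).
Proof.
move=> [M [Mr hM]]; exists M; split=> // x Mx w _ /=.
rewrite normrM; apply: le_trans (hM x Mx w I).
rewrite indicE; case: (w \in B); first by rewrite normr1 mul1r.
by rewrite normr0 mul0r.
Qed.

Lemma indicM_out X B w : ~ B w -> \1_B w * X w = 0.
Proof. by move=> nBw; rewrite indicE memNset // mul0r. Qed.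

Definition condg X (hX : bounded_fun X) B (hB : B !=set0) : cgamble :=
  CGamble hB (bounded_indicM B hX) (@indicM_out X B).

Lemma condgP X Y (hX : bounded_fun X) (hY : bounded_fun Y)
    B B' (hB : B !=set0) (hB' : B' !=set0) :
  condg hX hB = condg hY hB' <-> B = B' /\ {in B, X =1 Y}.
Proof.
split=> [e|[eB eX]].
  have eB : B = B' by have := congr1 (@cg_cond Omega R) e.
  split=> // w wB; have := congr1 (fun G : cgamble => G w) e => /=.
  by rewrite -eB !indicE wB !mul1r.
apply: cgamble_eq => //=; subst B'; apply/funext => w; rewrite !indicE.
by case: (boolP (w \in B)) => wB; rewrite ?mul0r // eX.
Qed.

Lemma bounded_indic A : bounded_fun (\1_A : Omega -> R).
Proof.
exists 1; split=> // x x1 w _ /=; apply/ltW/(le_lt_trans _ x1).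
by rewrite indicE; case: (w \in A); rewrite ?normr1 ?normr0.
Qed.

Definition cevent A B (hB : B !=set0) : cgamble := condg (bounded_indic A) hB.

Definition cevents : set cgamble :=
  [set G | exists A B (hB : B !=set0), G = cevent A hB].

Lemma bounded_opp X : bounded_fun X -> bounded_fun (fun w => - X w).
Proof. by move=> [M [Mr hM]]; exists M; split=> // x Mx w _; rewrite /= normrN; exact: hM. Qed.

Lemma opp_out (G : cgamble) w : ~ cg_cond G w -> - G w = 0.
Proof. by move=> h; rewrite cg_out ?oppr0. Qed.

Definition cg_opp (G : cgamble) : cgamble :=
  CGamble (cg_cond_neq0 G) (bounded_opp (cg_bounded G)) (@opp_out G).

Lemma cg_oppK : involutive cg_opp.
Proof. by move=> G; apply: cgamble_eq => //=; apply/funext => w; rewrite opprK. Qed.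

(* 0|B, which is also the conditional event set0|B *)
Definition cg_zero B (hB : B !=set0) : cgamble := cevent set0 hB.

(* A prevision on a set S of conditional gambles is a function of all
   conditional gambles, of which only the values on S matter. *)

Definition gain (P : cgamble -> R) n (G0 : cgamble) (G : 'I_n -> cgamble)
    (s0 : R) (s : 'I_n -> R) (w : Omega) : R :=
  \sum_(i < n) s i * (\1_(cg_cond (G i)) w * (G i w - P (G i)))
  - s0 * (\1_(cg_cond G0) w * (G0 w - P G0)).

Definition gain_cond n (G0 : cgamble) (G : 'I_n -> cgamble) : set Omega :=
  cg_cond G0 `|` \bigcup_i cg_cond (G i).

Definition Wcoherent_lower (S : set cgamble) (P : cgamble -> R) : Prop :=
  forall n (G0 : cgamble) (G : 'I_n -> cgamble) (s0 : R) (s : 'I_n -> R),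
    S G0 -> (forall i, S (G i)) -> 0 <= s0 -> (forall i, 0 <= s i) ->
    0 <= sup (gain P G0 G s0 s @` gain_cond G0 G).

Definition convex_lower (S : set cgamble) (P : cgamble -> R) : Prop :=
  forall n (G0 : cgamble) (G : 'I_n -> cgamble) (s0 : R) (s : 'I_n -> R),
    S G0 -> (forall i, S (G i)) -> 0 <= s0 -> (forall i, 0 <= s i) ->
    \sum_(i < n) s i = s0 -> 0 < s0 ->
    0 <= sup (gain P G0 G s0 s @` gain_cond G0 G).

Definition Cconvex_lower (S : set cgamble) (P : cgamble -> R) : Prop :=
  convex_lower S P /\
  forall G, S G -> S (cg_zero (cg_cond_neq0 G)) /\
                   P (cg_zero (cg_cond_neq0 G)) = 0.

(* As [cg_opp] is involutive, this is the map -X|B |-> - P(X|B). *)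
Definition conjugate (P : cgamble -> R) : cgamble -> R :=
  fun G => - P (cg_opp G).

Definition Wcoherent_upper (S : set cgamble) (P : cgamble -> R) : Prop :=
  Wcoherent_lower (cg_opp @` S) (conjugate P).

Definition Cconvex_upper (S : set cgamble) (P : cgamble -> R) : Prop :=
  Cconvex_lower (cg_opp @` S) (conjugate P).

End ConditionalGambles.

Section Partitions.
Context {Omega : Type} (R : realType) (PP : set (set Omega)).
Implicit Types (A B C D E : set Omega).
Local Notation cgamble := (cgamble Omega R).

Definition is_partition : Prop := partition PP id [set: Omega].

Definition algebra_of : set (set Omega) :=
  [set A | exists2 F : set (set Omega), F `<=` PP & A = \bigcup_(e in F) e].

Definition cond_algebra : set cgamble :=
  [set G | exists A B (hB : B !=set0),
     [/\ algebra_of A, algebra_of B & G = cevent A hB]].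

Definition inner E : set Omega := \bigcup_(e in [set e | PP e /\ e `<=` E]) e.

Definition outer E : set Omega :=
  \bigcup_(e in [set e | PP e /\ e `&` E !=set0]) e.

Lemma sub_outer E : is_partition -> E `<=` outer E.
Proof.
move=> [cov _ _] w Ew; have [e Pe ew] : cover PP id w by rewrite cov.
by exists e => //; split=> //; exists w.
Qed.

Section Star.
Variables (hP : is_partition) (C D : set Omega) (hD : D !=set0).

Lemma lower_cond_neq0 : cevent C hD <> cevent D hD :> cgamble ->
  inner (C `&` D) `|` outer (~` C `&` D) !=set0.
Proof.
move=> CD; apply: contrapT => e0; apply: CD.
apply/condgP; split=> // w /set_mem Dw; rewrite !indicE (mem_set Dw).
rewrite mem_set //; apply: contrapT => nCw; apply: e0; exists w; right.
exact: (sub_outer hP).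
Qed.

Lemma upper_cond_neq0 : cevent C hD <> cevent set0 hD :> cgamble ->
  outer (C `&` D) `|` inner (~` C `&` D) !=set0.
Proof.
move=> C0; apply: contrapT => e0; apply: C0.
apply/condgP; split=> // w /set_mem Dw; rewrite !indicE in_set0.
rewrite memNset // => Cw; apply: e0; exists w; left.
exact: (sub_outer hP).
Qed.

Definition lower_star (h : cevent C hD <> cevent D hD :> cgamble) : cgamble :=
  cevent (inner (C `&` D)) (lower_cond_neq0 h).

Definition upper_star (h : cevent C hD <> cevent set0 hD :> cgamble) : cgamble :=
  cevent (outer (C `&` D)) (upper_cond_neq0 h).

End Star.

Definition zeros_of (S : set cgamble) : set cgamble :=
  [set cg_zero (cg_cond_neq0 G) | G in S].

Definition lower_extension (hP : is_partition) (EE : set cgamble)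
    (P Q : cgamble -> R) : Prop :=
  (forall G, cond_algebra G -> Q G = P G) /\
  (forall C D (hD : D !=set0) (h : cevent C hD <> cevent D hD :> cgamble),
     EE (cevent C hD) -> Q (cevent C hD) = P (lower_star hP h)).

Definition upper_extension (hP : is_partition) (EE : set cgamble)
    (P Q : cgamble -> R) : Prop :=
  (forall G, cond_algebra G -> Q G = P G) /\
  (forall C D (hD : D !=set0) (h : cevent C hD <> cevent set0 hD :> cgamble),
     EE (cevent C hD) -> Q (cevent C hD) = P (upper_star hP h)).

(* Value 0 on the events set0|D adjoined to the domain for C-convexity. *)
Definition null_on_adjoined (EE : set cgamble) (Q : cgamble -> R) : Prop :=
  forall G, zeros_of EE G -> ~ (cond_algebra `|` EE) G -> Q G = 0.

End Partitions.

(* Main.v *)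
(* Write A = C /\ D and N = ~C /\ D. Betting on C|D at price p wins 1 - p on A,
   loses p on N and pays nothing elsewhere; betting on (C|D)_* is the same bet
   with A and N replaced by A_* and N^*, at the same price. Hence the second bet
   never pays more than the first, while every block of the partition contains a
   point where the first pays exactly what the second pays on the whole block.
   Replacing all bets of a gain by their approximations, the new gain is constant
   on blocks and on each block is at most the old gain at a suitable point, so a
   uniform loss for the extension is a uniform loss for the original assessment.
   The chosen point may fall outside the old conditioning event, but then some
   bought bet with positive price and stake is lost on the block.
   Upper probabilities reduce to the same argument: selling C|D at price p is
   buying ~C|D at price 1 - p, and (C|D)^* is the complement of (~C|D)_*. *)
Require Import Defs.
From mathcomp Require Import all_boot all_order all_algebra.
From mathcomp Require Import all_classical all_reals all_analysis.
From mathcomp Require Import ring lra.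

Set Implicit Arguments.
Unset Strict Implicit.
Unset Printing Implicit Defensive.

Import Order.TTheory GRing.Theory Num.Theory.

Local Open Scope classical_set_scope.
Local Open Scope ring_scope.

(** * Saturated events, and inner and outer approximations by blocks *)

Section Blocks.
Context {Omega : Type} (PP : set (set Omega)).
Implicit Types (E : set Omega) (w : Omega).

Definition same_block w w' := exists2 e, PP e & e w /\ e w'.

(** Pointwise form of membership in the algebra of the partition (see [algebra_ofP]), which spares
    handling families of blocks. *)
Definition saturated E := forall w w', same_block w w' -> E w -> E w'.

Lemma same_block_sym w w' : same_block w w' -> same_block w' w.
Proof. by move=> [e Pe [ew ew']]; exists e. Qed.

Lemma saturated0 : saturated set0. Proof. by []. Qed.

Lemma saturatedI E E' : saturated E -> saturated E' -> saturated (E `&` E').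
Proof. by move=> sE sE' w w' ww' [Ew E'w]; split; [exact: sE Ew|exact: sE' E'w]. Qed.

Lemma saturatedU E E' : saturated E -> saturated E' -> saturated (E `|` E').
Proof. by move=> sE sE' w w' ww' [/sE|/sE'] h; [left|right]; exact: h. Qed.

Lemma saturatedC E : saturated E -> saturated (~` E).
Proof. by move=> sE w w' /same_block_sym/sE h + /h; exact. Qed.

Lemma saturated_indic (R : realType) E w w' :
  saturated E -> same_block w w' -> \1_E w = \1_E w' :> R.
Proof.
move=> sE ww'; rewrite !indicE; congr (_ %:R); congr nat_of_bool.
by apply/idP/idP => /set_mem h; apply/mem_set; apply: sE h => //; exact: same_block_sym.
Qed.

Hypothesis hP : is_partition PP.

Lemma same_block_refl w : same_block w w.
Proof.
have [cov _ _] := hP; have [e Pe ew] : (cover PP id w) by rewrite cov.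
by exists e.
Qed.

Lemma block_eq e e' w : PP e -> PP e' -> e w -> e' w -> e = e'.
Proof. by move=> Pe Pe' ew e'w; have [_ tI _] := hP; apply: tI => //; exists w. Qed.

Lemma innerP E w : inner PP E w <-> forall w', same_block w w' -> E w'.
Proof.
split=> [[e [Pe eE] ew] w' [e' Pe' [e'w e'w']]|h].
  by apply: eE; rewrite (block_eq Pe Pe' ew e'w).
have [e Pe [ew _]] := same_block_refl w.
by exists e => //; split=> // w' ew'; apply: h; exists e.
Qed.

Lemma outerP E w : outer PP E w <-> exists2 w', same_block w w' & E w'.
Proof.
split=> [[e [Pe [w' [ew' Ew']]] ew]|[w' [e Pe [ew ew']] Ew']].
  by exists w' => //; exists e.
by exists e => //; split=> //; exists w'.
Qed.

Lemma saturated_inner E : saturated (inner PP E).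
Proof. by move=> w w' [e Pe [ew ew']] [f [Pf fE] fw]; exists f => //; rewrite (block_eq Pf Pe fw ew). Qed.

Lemma saturated_outer E : saturated (outer PP E).
Proof. by move=> w w' [e Pe [ew ew']] [f [Pf fE] fw]; exists f => //; rewrite (block_eq Pf Pe fw ew). Qed.

Lemma inner_sub E : inner PP E `<=` E.
Proof. by move=> w [e [_ eE] /eE]. Qed.

Lemma inner_saturated E : saturated E -> inner PP E = E.
Proof.
move=> sE; apply/seteqP; split; first exact: inner_sub.
by move=> w Ew; apply/innerP => w' /sE; exact.
Qed.

Lemma outer_saturated E : saturated E -> outer PP E = E.
Proof.
move=> sE; apply/seteqP; split; last by move=> w; exact: sub_outer.
by move=> w /outerP[w' /same_block_sym/sE]; exact.
Qed.

Lemma inner_outer_disjoint E E' :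
  E `&` E' = set0 -> inner PP E `&` outer PP E' = set0.
Proof.
move=> EE'; apply/seteqP; split=> // w [/innerP iE /outerP[w' /iE Ew' E'w']].
by have : (E `&` E') w' by []; rewrite EE'.
Qed.

Lemma algebra_ofP E : algebra_of PP E <-> saturated E.
Proof.
split=> [[F FP ->] w w' [e Pe [ew ew']] [f Ff fw]|sE].
  by exists f => //; rewrite (block_eq (FP _ Ff) Pe fw ew).
by exists [set e | PP e /\ e `<=` E]; [move=> e []|rewrite -[LHS](inner_saturated sE)].
Qed.

End Blocks.

(** * Conditional events seen as bets *)

Section Bets.
Context {Omega : Type} {R : realType}.
Implicit Types (A N C D : set Omega) (w : Omega) (p : R).
Local Notation cgamble := (cgamble Omega R).
Implicit Types (P Q : cgamble -> R) (G : cgamble) (T S : set cgamble).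

(** Convertible to the unit-stake summand of [gain]. *)
Definition payoff Q G w := \1_(cg_cond G) w * (G w - Q G).

Lemma payoff_out Q G w : ~ cg_cond G w -> payoff Q G w = 0.
Proof. by move=> h; rewrite /payoff indicE memNset ?mul0r. Qed.

Lemma payoff_opp Q G w : payoff (conjugate Q) (cg_opp G) w = - payoff Q G w.
Proof. by rewrite /payoff /conjugate cg_oppK /= -mulrN opprB addrC opprK. Qed.

(* The payoff of a unit bet at price p that is won on A, lost on N, and called
   off elsewhere. *)
Definition bet A N p w : R := \1_A w * (1 - p) - \1_N w * p.

Lemma betC A N p w : - bet A N p w = bet N A (1 - p) w.
Proof. by rewrite /bet; ring. Qed.

Lemma bet_win A N p w : A `&` N = set0 -> A w -> bet A N p w = 1 - p.
Proof.
move=> AN Aw; rewrite /bet !indicE mem_set // memNset ?mul1r ?mul0r ?subr0 //.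
by move=> Nw; have : (A `&` N) w by []; rewrite AN.
Qed.

Lemma bet_lose A N p w : A `&` N = set0 -> N w -> bet A N p w = - p.
Proof.
move=> AN Nw; rewrite -[LHS]opprK betC bet_win 1?setIC //; ring.
Qed.

Lemma bet_off A N p w : ~ A w -> ~ N w -> bet A N p w = 0.
Proof. by move=> Aw Nw; rewrite /bet !indicE !memNset // !mul0r subr0. Qed.

(** Independent of any representation C|D, so that it covers conditional events as well as their
    opposites, at an explicit price. *)
Definition bets Q G A N p := cg_cond G = A `|` N /\ payoff Q G =1 bet A N p.

Lemma cevent_bets Q C D (hD : D !=set0) :
  bets Q (cevent C hD) (C `&` D) (~` C `&` D) (Q (cevent C hD)).
Proof.
split=> /=; first by rewrite -setIUl setUv setTI.
move=> w; set q := Q _.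
have CD : (C `&` D) `&` (~` C `&` D) = set0 by rewrite setIACA setICr set0I.
rewrite /payoff -/q /=; have [Dw|Dw] := pselect (D w); last first.
  by rewrite indicE memNset // mul0r bet_off // => -[].
rewrite !indicE (mem_set Dw) !mul1r.
have [Cw|Cw] := pselect (C w); first by rewrite bet_win // mem_set.
by rewrite bet_lose // memNset // sub0r.
Qed.

Lemma opp_bets Q G A N p :
  bets Q G A N p -> bets (conjugate Q) (cg_opp G) N A (1 - p).
Proof. by move=> [cG pG]; split=> [|w]; [rewrite setUC|rewrite payoff_opp pG betC]. Qed.

Lemma indic_eqP C C' w : \1_C w = \1_C' w :> R <-> (C w <-> C' w).
Proof.
rewrite !indicE; split=> [/eqP|CC'].
  rewrite eqr_nat => /eqP CC'.
  have {}CC' : (w \in C) = (w \in C') by case: (w \in C) CC'; case: (w \in C').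
  by split=> /mem_set h; apply: set_mem; rewrite ?CC' // -CC'.
by congr (nat_of_bool _)%:R; apply/idP/idP => /set_mem/CC'/mem_set.
Qed.

(** The right-hand side isolates what a bet sees of C and D: where it is won and where it is lost.
    The stars depend on nothing else. *)
Lemma cevent_eqP C C' D D' (hD : D !=set0) (hD' : D' !=set0) :
  cevent C hD = cevent C' hD' :> cgamble <->
  C `&` D = C' `&` D' /\ ~` C `&` D = ~` C' `&` D'.
Proof.
split=> [/condgP[DD' CC']|[CD NCD]].
  have CC'w w : D w -> C w <-> C' w by move=> /mem_set/CC'/indic_eqP.
  by rewrite -DD'; split; apply/seteqP; split=> w [+ Dw]; have := CC'w w Dw; rewrite /setI /setC /=; tauto.
have DD' : D = D'.
  by rewrite -[D]setTI -(setUv C) setIUl CD NCD -setIUl setUv setTI.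
apply/condgP; split=> // w /set_mem Dw; apply/indic_eqP.
have D'w : D' w by rewrite -DD'.
have : (C `&` D) w <-> (C' `&` D') w by rewrite CD.
by rewrite /setI /=; tauto.
Qed.

End Bets.

(** * Approximation of bets by block-invariant bets *)

Section Approximation.
Context {Omega : Type} {R : realType} (PP : set (set Omega)).
Local Notation cgamble := (cgamble Omega R).
Context (T : set cgamble) (P Q : cgamble -> R).
Implicit Types (A N : set Omega) (w : Omega) (p : R) (G H : cgamble).

Definition block_invariant G :=
  forall w w', same_block PP w w' -> G w = G w' /\ (cg_cond G w -> cg_cond G w').

(** Both bets share the price p: this is how the defining equation of the extension enters. [T] will
    be the conditional algebra or the set of opposites of its members. *)
Definition approximable G := exists A N p G',
  [/\ A `&` N = set0, 0 <= p <= 1, T G',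
      bets Q G A N p & bets P G' (inner PP A) (outer PP N) p].

Hypothesis hP : is_partition PP.

(** On [outer PP N] the approximating bet pays -p, the least of -p, 0 and 1 - p. Elsewhere N is
    excluded, so off [inner PP A] it pays 0 against 0 or 1 - p. *)
Lemma bet_inner_outer_le A N p w : A `&` N = set0 -> 0 <= p <= 1 ->
  bet (inner PP A) (outer PP N) p w <= bet A N p w.
Proof.
move=> AN /andP[p0 p1]; have AN' := inner_outer_disjoint hP AN.
have [iAw|iAw] := pselect (inner PP A w).
  by rewrite !bet_win //; exact: inner_sub iAw.
have [oNw|oNw] := pselect (outer PP N w).
  rewrite (bet_lose _ AN') //.
  have [Aw|Aw] := pselect (A w); first by rewrite bet_win //; lra.
  have [Nw|Nw] := pselect (N w); first by rewrite bet_lose.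
  by rewrite bet_off //; lra.
have Nw : ~ N w by move=> Nw; apply: oNw; exact: sub_outer.
rewrite [X in X <= _]bet_off //.
have [Aw|Aw] := pselect (A w); first by rewrite bet_win //; lra.
by rewrite bet_off.
Qed.

(** A block inside A keeps w, a block meeting N offers a point of N, and any other block has a point
    outside A and N, where the bet is called off. In that last case the approximating bet is called
    off at w too. *)
Lemma bet_inner_outer_attained A N p w : A `&` N = set0 ->
  exists w', [/\ same_block PP w w',
    bet A N p w' = bet (inner PP A) (outer PP N) p w &
    (inner PP A `|` outer PP N) w -> (A `|` N) w'].
Proof.
move=> AN; have AN' := inner_outer_disjoint hP AN.
have [iAw|iAw] := pselect (inner PP A w).
  exists w; split; first exact: same_block_refl.
    by rewrite !bet_win //; exact: inner_sub iAw.
  by left; exact: inner_sub iAw.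
have [oNw|oNw] := pselect (outer PP N w).
  have [w' ww' Nw'] := (outerP PP N w).1 oNw.
  by exists w'; split=> //; [rewrite !bet_lose|right].
have [w' [ww' nAw']] : exists w', same_block PP w w' /\ ~ A w'.
  apply: contrapT => h; apply: iAw; apply/(innerP hP) => w' ww'.
  by apply: contrapT => nAw'; apply: h; exists w'.
exists w'; split=> // [|[]//].
rewrite !bet_off // => Nw'; apply: oNw; apply/outerP; by exists w'.
Qed.

Hypothesis T_invariant : forall G, T G -> block_invariant G.
Hypothesis T_zero : forall G, T G ->
  T (cg_zero (cg_cond_neq0 G)) /\ P (cg_zero (cg_cond_neq0 G)) = 0.

Lemma payoff_zero H w : T H -> payoff P (cg_zero (cg_cond_neq0 H)) w = 0.
Proof.
by move=> TH; rewrite /payoff (T_zero TH).2 /= indic0 mulr0 subrr mulr0.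
Qed.

Lemma payoff_invariant G w w' : T G -> same_block PP w w' ->
  payoff P G w = payoff P G w'.
Proof.
move=> TG ww'; rewrite /payoff (T_invariant TG ww').1; congr (_ * _).
apply: (saturated_indic _ _ ww') => v v' vv'.
exact: (T_invariant TG vv').2.
Qed.

(* A bet with zero stake or zero price is replaced by the null bet on the
   conditioning event of H: its own approximation might enlarge the conditioning
   event without producing a strict loss there. *)
Lemma approximable_bought G H s : approximable G -> T H -> 0 <= s ->
  exists G' c, [/\ T G', 0 < c,
    forall w, s * payoff P G' w <= s * payoff Q G w &
    forall w, cg_cond G' w -> ~ cg_cond H w -> ~ cg_cond G w ->
      s * payoff P G' w <= - c].
Proof.
move=> [A [N [p [G' [AN p01 TG' [cG pG] [cG' pG']]]]]] TH s0.
have [s_eq0|s_neq0] := eqVneq s 0.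
  (* The value 1 is arbitrary: the null bet has the conditioning event of [H], so the last condition
     is void. *)
  exists (cg_zero (cg_cond_neq0 H)), 1; split=> //; first exact: (T_zero TH).1.
  by move=> w; rewrite s_eq0 !mul0r.
have [p_eq0|p_neq0] := eqVneq p 0.
  exists (cg_zero (cg_cond_neq0 H)), 1; split=> //; first exact: (T_zero TH).1.
  move=> w; rewrite payoff_zero // mulr0 mulr_ge0 // pG p_eq0 /bet.
  by rewrite mulr0 !subr0 mulr1 indicE ler0n.
have sgt0 : 0 < s by rewrite lt0r s_neq0.
have pgt0 : 0 < p by rewrite lt0r p_neq0; case/andP: p01.
(* Off the conditioning event of [G] the approximation can only be in its losing part, which costs s
   * p. *)
exists G', (s * p); split=> //; first exact: mulr_gt0.
  by move=> w; rewrite ler_wpM2l // pG pG' bet_inner_outer_le.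
move=> w; rewrite cG' cG pG' => -[iA _ []|oN _ _].
  by left; exact: inner_sub iA.
by rewrite bet_lose ?mulrN //; exact: inner_outer_disjoint.
Qed.

Lemma approximable_sold G : approximable G ->
  exists2 G', T G' & forall w, exists w', [/\ same_block PP w w',
    payoff Q G w' = payoff P G' w & cg_cond G' w -> cg_cond G w'].
Proof.
move=> [A [N [p [G' [AN p01 TG' [cG pG] [cG' pG']]]]]]; exists G' => // w.
by have [w' h] := bet_inner_outer_attained p w AN; exists w'; rewrite cG cG' pG pG'.
Qed.

(** The stakes are kept, so any constraint on them passes to the approximating gain, and one
    argument serves W-coherence and convexity alike. *)
Lemma sup_gain_approximable n G0 (G : 'I_n -> cgamble) s0 (s : 'I_n -> R) :
  approximable G0 -> (forall i, approximable (G i)) -> (forall i, 0 <= s i) ->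
  (forall G0' (G' : 'I_n -> cgamble), T G0' -> (forall i, T (G' i)) ->
     0 <= sup (gain P G0' G' s0 s @` gain_cond G0' G')) ->
  0 <= sup (gain Q G0 G s0 s @` gain_cond G0 G).
Proof.
move=> apG0 apG s_ge0 coh.
have [G0' TG0' sold] := approximable_sold apG0.
have [G' /choice[c bought]] := choice (fun i => approximable_bought (apG i) TG0' (s_ge0 i)).
have TG' i : T (G' i) by case: (bought i).
have := coh _ _ TG0' TG'; rewrite !leNgt; apply: contraNN.
set E := (X in sup X < 0) => supE.
(* [sup] takes the default value 0 on sets without a supremum, so a negative value is a genuine
   one. *)
have E_has_sup : has_sup E.
  by apply: contrapT => /sup_out E0; rewrite E0 ltxx in supE.
(* The uniform loss of the approximating gain: [- sup E] serves when the chosen point lies in the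
   old conditioning event, the [c i] serve otherwise. *)
pose d := \big[Order.min/- sup E]_i c i.
have d_gt0 : 0 < d.
  by apply: lt_bigmin => [|i _]; [rewrite oppr_gt0|case: (bought i)].
suff le_d w : gain_cond G0' G' w -> gain P G0' G' s0 s w <= - d.
  apply: (@le_lt_trans _ _ (- d)); last by rewrite oppr_lt0.
  apply: ge_sup => [|_ [w Bw <-]]; last exact: le_d.
  by have [w Bw] := cg_cond_neq0 G0'; exists (gain P G0' G' s0 s w), w => //; left.
move=> Bw; have [w' [ww' pw' cw']] := sold w.
(* Bought approximations are constant on the block of w, and w' was chosen so that the sold bet pays
   there what its approximation pays at w. *)
have -> : gain P G0' G' s0 s w =
    \sum_(i < n) s i * payoff P (G' i) w' - s0 * payoff Q G0 w'.
  rewrite pw'; congr (_ - _); apply: eq_bigr => i _; congr (_ * _).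
  exact: payoff_invariant.
have [Bw'|nBw'] := pselect (gain_cond G0 G w').
  apply: (@le_trans _ _ (sup E)); last by rewrite lerNr bigmin_le_id.
  apply: (@le_trans _ _ (gain Q G0 G s0 s w')).
    by rewrite lerB // ler_sum // => i _; case: (bought i).
  by apply: sup_upper_bound => //; exists w'.
have nG0w' : ~ cg_cond G0 w' by move=> h; apply: nBw'; left.
have nGw' i : ~ cg_cond (G i) w' by move=> h; apply: nBw'; right; exists i.
have nG0'w : ~ cg_cond G0' w by move=> /cw'.
(* The sold approximation is called off at w, so some bought one is not. It loses at least [c i] at
   w', where every other bought approximation is dominated by a called-off bet. *)
case: Bw => // -[i _ G'iw].
rewrite payoff_out // mulr0 subr0 (bigD1 i) //=.
apply: (@le_trans _ _ (- c i + 0)); last by rewrite addr0 lerN2 bigmin_le.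
apply: lerD.
  have [_ _ _] := bought i; apply=> //; first exact: (T_invariant (TG' i) ww').2.
  by move/(T_invariant TG0' (same_block_sym ww')).2.
apply: sumr_le0 => j _; have [_ _ le_j _] := bought j.
by apply: le_trans (le_j w') _; rewrite payoff_out // mulr0.
Qed.

End Approximation.

(** * Consequences of coherence, and its transfer along approximations *)

Section Coherence.
Context {Omega : Type} {R : realType}.
Local Notation cgamble := (cgamble Omega R).
Implicit Types (P Q : cgamble -> R) (G H : cgamble) (T S : set cgamble).

(** Betting on a null event against itself gives a gain constant on its conditioning event, and
    W-coherence, unlike convexity, allows unbalanced stakes. *)
Lemma Wcoherent_Cconvex T P :
  (forall G, T G -> T (cg_zero (cg_cond_neq0 G))) ->
  Wcoherent_lower T P -> Cconvex_lower T P.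
Proof.
move=> T0 coh; split=> [n G0 G s0 s TG0 TG s0_ge0 s_ge0 _ _|G TG].
  exact: coh.
split; first exact: T0.
set Z := cg_zero _; have TZ : T Z by exact: T0.
have [w Zw] := cg_cond_neq0 Z.
have gainZ n (t0 : R) (t : 'I_n -> R) v : cg_cond Z v ->
    gain P Z (fun=> Z) t0 t v = (t0 - \sum_i t i) * P Z.
  move=> Zv.
  have pZ : payoff P Z v = - P Z.
    by rewrite /payoff indicE mem_set //= indic0 mulr0 sub0r mul1r.
  rewrite -[LHS]/(\sum_i t i * payoff P Z v - t0 * payoff P Z v) pZ -mulr_suml.
  by ring.
have ge0 n (t0 : R) (t : 'I_n -> R) : 0 <= t0 -> (forall i, 0 <= t i) ->
    0 <= (t0 - \sum_i t i) * P Z.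
  move=> t0_ge0 t_ge0.
  apply: le_trans (coh n Z (fun=> Z) t0 t TZ (fun=> TZ) t0_ge0 t_ge0) _.
  apply: ge_sup => [|_ [v Zv <-]]; last by rewrite gainZ //; case: Zv => // -[].
  by exists (gain P Z (fun=> Z) t0 t w), w => //; left.
(* A lone purchase gives [P Z <= 0], a lone sale gives [0 <= P Z]. *)
apply/eqP; rewrite eq_le -oppr_ge0; apply/andP; split.
  have := ge0 1 0 (fun=> 1) (lexx 0) (fun=> ler01).
  by rewrite big_ord1 sub0r mulN1r.
have := ge0 0 1 (fun=> 0) ler01 (fun=> lexx 0).
by rewrite big_ord0 subr0 mul1r.
Qed.

(** Trade [G] against the null bet on the same event at unit stakes, balanced as convexity requires:
    selling [G] bounds its price below, buying it bounds it above. *)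
Lemma Cconvex_bounds T P G a b : Cconvex_lower T P -> T G ->
  (forall w, cg_cond G w -> a <= G w <= b) -> a <= P G <= b.
Proof.
move=> [conv T0] TG abG; have [TZ PZ] := T0 _ TG; set Z := cg_zero _ in TZ PZ.
have sup_gain H H' c : T H -> T H' ->
    (forall w, (cg_cond H `|` cg_cond H') w -> payoff P H' w - payoff P H w <= c) ->
    0 <= c.
  move=> TH TH' gain_le.
  apply: le_trans (conv 1%N H (fun=> H') 1 (fun=> 1) TH (fun=> TH') ler01 _ _ ltr01) _.
  - by move=> i.
  - by rewrite big_ord1.
  apply: ge_sup => [|_ [w Bw <-]].
    by have [w Hw] := cg_cond_neq0 H; eexists; exists w; first by left.
  rewrite /gain big_ord1 !mul1r; apply: gain_le.
  by case: Bw => [|[i _]]; [left|right].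
have payoffZ w : payoff P Z w = 0 by rewrite /payoff PZ /= indic0 mulr0 subrr mulr0.
have payoffG w : cg_cond G w -> payoff P G w = G w - P G.
  by move=> Gw; rewrite /payoff indicE mem_set // mul1r.
apply/andP; split; rewrite -subr_ge0.
  apply: (sup_gain G Z) => // w Gw; rewrite payoffZ.
  have {}Gw : cg_cond G w by case: Gw.
  by rewrite payoffG //; have /andP[] := abG w Gw; lra.
apply: (sup_gain Z G) => // w Gw; rewrite payoffZ.
have {}Gw : cg_cond G w by case: Gw.
by rewrite payoffG //; have /andP[] := abG w Gw; lra.
Qed.

Context (PP : set (set Omega)) (hP : is_partition PP).
Context (T S : set cgamble) (P Q : cgamble -> R).
Hypothesis T_invariant : forall G, T G -> block_invariant PP G.
Hypothesis S_approximable : forall G, S G -> approximable PP T P Q G.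

Lemma convex_approximable : Cconvex_lower T P -> convex_lower S Q.
Proof.
move=> [conv T0] n G0 G s0 s SG0 SG s0_ge0 s_ge0 sE s0_gt0.
apply: (sup_gain_approximable hP T_invariant T0) => // [|i|G0' G' TG0' TG'].
- exact: S_approximable.
- exact: S_approximable.
- exact: conv.
Qed.

Lemma Wcoherent_approximable :
  (forall G, T G -> T (cg_zero (cg_cond_neq0 G))) ->
  Wcoherent_lower T P -> Wcoherent_lower S Q.
Proof.
move=> T0 coh n G0 G s0 s SG0 SG s0_ge0 s_ge0.
have [_ T0'] := Wcoherent_Cconvex T0 coh.
apply: (sup_gain_approximable hP T_invariant T0') => // [|i|G0' G' TG0' TG'].
- exact: S_approximable.
- exact: S_approximable.
- exact: coh.
Qed.

End Coherence.

(** [star] is a relation because the approximation takes a representation C|D and a proof as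
    arguments. The hypotheses make it single-valued, and exact on [T], which may overlap [EE]. *)
Lemma exists_extension (Omega : Type) (R : realType)
    (T EE : set (cgamble Omega R)) (P : cgamble Omega R -> R)
    (star : cgamble Omega R -> cgamble Omega R -> Prop) :
  (forall G H H', star G H -> star G H' -> H = H') ->
  (forall G H, T G -> star G H -> H = G) ->
  exists Q : cgamble Omega R -> R,
    [/\ forall G, T G -> Q G = P G,
        forall G H, EE G -> star G H -> Q G = P H &
        forall G, ~ (T `|` EE) G -> Q G = 0].
Proof.
move=> star_fun star_id.
(* [V G] has at most one element. The default 0 of [xget] outside the domain realizes the convention
   on adjoined null events. *)
pose V G := [set r | (T G /\ r = P G) \/ (EE G /\ exists2 H, star G H & r = P H)].
exists (fun G => xget 0 (V G)); split=> [G TG|G H EG GH|G nG].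
- apply: xget_unique; first by left.
  by move=> _ [[_ ->]//|[_ [H GH ->]]]; rewrite (star_id _ _ TG GH).
- apply: xget_unique; first by right; split=> //; exists H.
  move=> _ [[TG ->]|[_ [H' GH' ->]]]; first by rewrite (star_id _ _ TG GH).
  by rewrite (star_fun _ _ _ GH GH').
- by apply: xgetPN => r [[TG _]|[EG _]]; apply: nG; [left|right].
Qed.

(** * Stars of conditional events, and the approximable events *)

Section Stars.
Context {Omega : Type} {R : realType} (PP : set (set Omega)).
Hypothesis hP : is_partition PP.
Implicit Types (A B N C D : set Omega).
Local Notation cgamble := (cgamble Omega R).
Implicit Types (P Q : cgamble -> R) (G H : cgamble).
Local Notation AC := (@cond_algebra Omega R PP).

Lemma cond_algebra_cevent A B (hB : B !=set0) :
  saturated PP A -> saturated PP B -> AC (cevent A hB).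
Proof. by move=> sA sB; exists A, B, hB; split=> //; apply/(algebra_ofP hP). Qed.

(** The representation C|D is arbitrary, so C need not lie in the algebra, but its trace on D
    does. *)
Lemma cond_algebra_saturated C D (hD : D !=set0) : AC (cevent C hD) ->
  saturated PP (C `&` D) /\ saturated PP (~` C `&` D).
Proof.
move=> [A [B [hB [/(algebra_ofP hP) sA /(algebra_ofP hP) sB /cevent_eqP[-> ->]]]]].
by split; apply: saturatedI => //; exact: saturatedC.
Qed.

Lemma cond_algebra_invariant G : AC G -> block_invariant PP G.
Proof.
move=> [A [B [hB [/(algebra_ofP hP) sA /(algebra_ofP hP) sB ->]]]] w w' ww'.
split=> /=; last exact: sB.
by congr (_ * _); exact: saturated_indic ww'.
Qed.

Lemma cond_algebra_zero G : AC G -> AC (cg_zero (cg_cond_neq0 G)).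
Proof.
move=> [A [B [hB [_ /(algebra_ofP hP) sB ->]]]].
by apply: cond_algebra_cevent => //; exact: saturated0.
Qed.

Lemma cg_opp_zero B (hB : B !=set0) : cg_opp (cg_zero hB) = cg_zero hB :> cgamble.
Proof. by apply: cgamble_eq => //=; apply/funext => w; rewrite indic0 mulr0 oppr0. Qed.

Lemma cond_algebra_opp_invariant G : (cg_opp @` AC) G -> block_invariant PP G.
Proof.
move=> [H /cond_algebra_invariant iH <-] w w' /iH[eH cH].
by split=> //=; rewrite eH.
Qed.

Lemma cond_algebra_opp_zero G : (cg_opp @` AC) G ->
  (cg_opp @` AC) (cg_zero (cg_cond_neq0 G)).
Proof.
move=> [H ACH <-]; exists (cg_zero (cg_cond_neq0 H)); last exact: cg_opp_zero.
exact: cond_algebra_zero.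
Qed.

Lemma setI_disjointU A N : A `&` N = set0 ->
  A `&` (A `|` N) = A /\ ~` A `&` (A `|` N) = N.
Proof.
move=> AN; split; first by apply/setIidl => w; left.
rewrite setIUr setICl set0U; apply/setIidr => w Nw Aw.
by have : (A `&` N) w by []; rewrite AN.
Qed.

Lemma cevent_bets_disjoint P A N (h : A `|` N !=set0) : A `&` N = set0 ->
  bets P (cevent A h) A N (P (cevent A h)).
Proof.
by move=> /setI_disjointU[eA eN]; have := cevent_bets P A h; rewrite eA eN.
Qed.

Lemma cevent_disjoint C D : (C `&` D) `&` (~` C `&` D) = set0.
Proof. by rewrite setIACA setICr set0I. Qed.

Lemma cevent_disjointC C D : (~` C `&` D) `&` (C `&` D) = set0.
Proof. by rewrite setIC cevent_disjoint. Qed.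

Lemma lower_star_eq C C' D D' (hD : D !=set0) (hD' : D' !=set0)
    (h : cevent C hD <> cevent D hD :> cgamble)
    (h' : cevent C' hD' <> cevent D' hD' :> cgamble) :
  cevent C hD = cevent C' hD' :> cgamble -> lower_star hP h = lower_star hP h'.
Proof. by move=> /cevent_eqP[eA eN]; apply/cevent_eqP; rewrite eA eN. Qed.

Lemma upper_star_eq C C' D D' (hD : D !=set0) (hD' : D' !=set0)
    (h : cevent C hD <> cevent set0 hD :> cgamble)
    (h' : cevent C' hD' <> cevent set0 hD' :> cgamble) :
  cevent C hD = cevent C' hD' :> cgamble -> upper_star hP h = upper_star hP h'.
Proof. by move=> /cevent_eqP[eA eN]; apply/cevent_eqP; rewrite eA eN. Qed.

(** For use where [EE] meets the algebra: there the two clauses of the extension must agree. *)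
Lemma lower_star_id C D (hD : D !=set0)
    (h : cevent C hD <> cevent D hD :> cgamble) :
  AC (cevent C hD) -> lower_star hP h = cevent C hD.
Proof.
move=> /cond_algebra_saturated[sA sN]; apply/cevent_eqP.
rewrite (inner_saturated hP sA) (outer_saturated hP sN).
exact: setI_disjointU (cevent_disjoint C D).
Qed.

Lemma upper_star_id C D (hD : D !=set0)
    (h : cevent C hD <> cevent set0 hD :> cgamble) :
  AC (cevent C hD) -> upper_star hP h = cevent C hD.
Proof.
move=> /cond_algebra_saturated[sA sN]; apply/cevent_eqP.
rewrite (outer_saturated hP sA) (inner_saturated hP sN).
exact: setI_disjointU (cevent_disjoint C D).
Qed.

Lemma cond_algebra_lower_star C D (hD : D !=set0)
    (h : cevent C hD <> cevent D hD :> cgamble) : AC (lower_star hP h).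
Proof.
apply: cond_algebra_cevent; first exact: saturated_inner.
by apply: saturatedU; [exact: saturated_inner|exact: saturated_outer].
Qed.

Lemma cond_algebra_upper_star C D (hD : D !=set0)
    (h : cevent C hD <> cevent set0 hD :> cgamble) : AC (upper_star hP h).
Proof.
apply: cond_algebra_cevent; first exact: saturated_outer.
by apply: saturatedU; [exact: saturated_outer|exact: saturated_inner].
Qed.

(** Supplies the price range on which approximation relies. *)
Lemma cond_algebra_bounds P G : Cconvex_lower AC P -> AC G -> 0 <= P G <= 1.
Proof.
move=> conv ACG; apply: (Cconvex_bounds conv ACG) => w _.
case: ACG => [A [B [hB [_ _ ->]]]] /=.
by rewrite !indicE; case: (_ \in _); case: (_ \in _); rewrite ?mulr0 ?mulr1 ?lexx ?ler01.
Qed.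

Lemma cond_algebra_upper_bounds P G : Cconvex_upper AC P -> AC G -> 0 <= P G <= 1.
Proof.
move=> conv ACG.
have : -1 <= conjugate P (cg_opp G) <= 0.
  apply: (Cconvex_bounds conv); first by exists G.
  move=> w _; case: ACG => [A [B [hB [_ _ ->]]]] /=.
  by rewrite !indicE; case: (_ \in _); case: (_ \in _);
    rewrite ?mulr0 ?mulr1 ?oppr0 ?lexx ?lerN10.
by rewrite /conjugate cg_oppK lerN2 oppr_le0 andbC.
Qed.

Lemma approximable_lower_star P Q C D (hD : D !=set0)
    (h : cevent C hD <> cevent D hD :> cgamble) :
  Cconvex_lower AC P -> Q (cevent C hD) = P (lower_star hP h) ->
  approximable PP AC P Q (cevent C hD).
Proof.
move=> conv QP; exists (C `&` D), (~` C `&` D), (P (lower_star hP h)), (lower_star hP h).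
have ACs := cond_algebra_lower_star h.
split=> //; first exact: cevent_disjoint.
- exact: cond_algebra_bounds.
- by rewrite -QP; exact: cevent_bets.
- by apply: cevent_bets_disjoint; apply: inner_outer_disjoint => //; exact: cevent_disjoint.
Qed.

(** Passing to opposites swaps winning and losing events and turns the price p into 1 - p, so the
    opposite of the upper star has an inner winning event and an outer losing one. *)
Lemma approximable_upper_star P Q C D (hD : D !=set0)
    (h : cevent C hD <> cevent set0 hD :> cgamble) :
  Cconvex_upper AC P -> Q (cevent C hD) = P (upper_star hP h) ->
  approximable PP (cg_opp @` AC) (conjugate P) (conjugate Q) (cg_opp (cevent C hD)).
Proof.
move=> conv QP.
have ACs := cond_algebra_upper_star h.
exists (~` C `&` D), (C `&` D), (1 - P (upper_star hP h)), (cg_opp (upper_star hP h)).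
have CDN := cevent_disjointC C D.
split=> //.
- by have := cond_algebra_upper_bounds conv ACs; lra.
- by rewrite -QP; apply: opp_bets; exact: cevent_bets.
- apply: opp_bets; apply: cevent_bets_disjoint.
  by rewrite setIC; exact: inner_outer_disjoint.
Qed.

(** Saturated events are their own inner and outer approximations, so the bet approximates
    itself. *)
Lemma approximable_saturated (T : set cgamble) P Q G A N p :
  saturated PP A -> saturated PP N -> A `&` N = set0 -> 0 <= p <= 1 -> T G ->
  Q G = P G -> bets P G A N p -> approximable PP T P Q G.
Proof.
move=> sA sN AN p01 TG QP bP; exists A, N, p, G.
rewrite (inner_saturated hP sA) (outer_saturated hP sN).
by split=> //; move: bP; rewrite /bets /payoff QP.
Qed.

Lemma approximable_cond_algebra P Q G : Cconvex_lower AC P -> AC G ->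
  Q G = P G -> approximable PP AC P Q G.
Proof.
move=> conv ACG; case: (ACG) => A [B [hB [_ _ GE]]] QP.
have [sA sN] : saturated PP (A `&` B) /\ saturated PP (~` A `&` B).
  by apply: (@cond_algebra_saturated A B hB); rewrite -GE.
apply: (approximable_saturated sA sN (cevent_disjoint A B)) (cond_algebra_bounds conv ACG) ACG QP _.
by rewrite GE; exact: cevent_bets.
Qed.

Lemma approximable_cond_algebra_opp P Q G : Cconvex_upper AC P -> AC G ->
  Q G = P G ->
  approximable PP (cg_opp @` AC) (conjugate P) (conjugate Q) (cg_opp G).
Proof.
move=> conv ACG; case: (ACG) => A [B [hB [_ _ GE]]] QP.
have [sA sN] : saturated PP (A `&` B) /\ saturated PP (~` A `&` B).
  by apply: (@cond_algebra_saturated A B hB); rewrite -GE.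
apply: (@approximable_saturated _ _ _ _ _ _ (1 - P G) sN sA (cevent_disjointC A B)).
- by have := cond_algebra_upper_bounds conv ACG; lra.
- by exists G.
- by rewrite /conjugate cg_oppK QP.
- by apply: opp_bets; rewrite GE; exact: cevent_bets.
Qed.

(** A null event is a bet never won and lost on D at price 0; the null bet on [outer PP D]
    approximates it, even when D is outside the algebra. *)
Lemma approximable_zero (T : set cgamble) P Q D (hD : D !=set0) :
  (forall B (hB : B !=set0), saturated PP B ->
     T (cg_zero hB) /\ P (cg_zero hB) = 0) ->
  Q (cg_zero hD) = 0 -> approximable PP T P Q (cg_zero hD).
Proof.
move=> T0 Q0; have hoD : outer PP D !=set0.
  by case: (hD) => w Dw; exists w; exact: sub_outer.
have [TZ PZ] := T0 _ hoD (@saturated_outer _ _ hP D).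
have zero_bets Q' B (hB : B !=set0) : Q' (cg_zero hB) = 0 ->
    bets Q' (cg_zero hB) set0 B 0.
  by move=> Q'0; have := cevent_bets Q' set0 hB; rewrite -/(cg_zero hB) Q'0 set0I setC0 setTI.
exists set0, D, 0, (cg_zero hoD); rewrite set0I lexx ler01; split=> //.
  exact: zero_bets.
by rewrite (inner_saturated hP) ?saturated0 //; apply: zero_bets.
Qed.

End Stars.

(** * Existence and consistency of the lower and upper extensions *)

Section Extensions.
Context {Omega : Type} {R : realType} (PP : set (set Omega)).
Hypothesis hP : is_partition PP.
Local Notation cgamble := (cgamble Omega R).
Context (EE : set cgamble).
Hypothesis EE_events : EE `<=` cevents.
Hypothesis EE_nontrivial : forall (C D : set Omega) (hD : D !=set0),
  EE (cevent C hD) ->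
  cevent C hD <> cevent set0 hD :> cgamble /\ cevent C hD <> cevent D hD :> cgamble.
Implicit Types (P Q : cgamble -> R) (G : cgamble).
Local Notation AC := (@cond_algebra Omega R PP).
Local Notation domain := (AC `|` EE).

Lemma zeros_notin G : zeros_of EE G -> ~ EE G.
Proof. by move=> [H _ <-] /EE_nontrivial[]. Qed.

Lemma exists_lower_extension P :
  exists Q, lower_extension hP EE P Q /\ null_on_adjoined PP EE Q.
Proof.
pose star G H := exists C D (hD : D !=set0) (h : cevent C hD <> cevent D hD :> cgamble),
  G = cevent C hD /\ H = lower_star hP h.
have [|G H ACG [C [D [hD [h [GE ->]]]]]|Q [QP Qstar Q0]] := @exists_extension _ _ AC EE P star.
- move=> _ _ _ [C [D [hD [h [-> ->]]]]] [C' [D' [hD' [h' [e ->]]]]].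
  exact: lower_star_eq.
- by rewrite GE in ACG *; exact: lower_star_id.
exists Q; split; first split=> // C D hD h EEC.
  by apply: Qstar => //; exists C, D, hD, h.
by move=> G _ /Q0.
Qed.

Lemma exists_upper_extension P :
  exists Q, upper_extension hP EE P Q /\ null_on_adjoined PP EE Q.
Proof.
pose star G H := exists C D (hD : D !=set0) (h : cevent C hD <> cevent set0 hD :> cgamble),
  G = cevent C hD /\ H = upper_star hP h.
have [|G H ACG [C [D [hD [h [GE ->]]]]]|Q [QP Qstar Q0]] := @exists_extension _ _ AC EE P star.
- move=> _ _ _ [C [D [hD [h [-> ->]]]]] [C' [D' [hD' [h' [e ->]]]]].
  exact: upper_star_eq.
- by rewrite GE in ACG *; exact: upper_star_id.
exists Q; split; first split=> // C D hD h EEC.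
  by apply: Qstar => //; exists C, D, hD, h.
by move=> G _ /Q0.
Qed.

(** An adjoined null event is never in [EE], whose members are nontrivial. In the algebra its value
    comes from [P], outside it from the convention. *)
Lemma zeros_null P Q : (forall G, AC G -> P (cg_zero (cg_cond_neq0 G)) = 0) ->
  (forall G, AC G -> Q G = P G) -> null_on_adjoined PP EE Q ->
  forall G, zeros_of EE G -> Q G = 0.
Proof.
move=> P0 QP Qnull G zG; have [ACG|nACG] := pselect (AC G).
  (* [P0] is applied to the null event itself, which is convertible to the null event on its own
     conditioning event. *)
  by rewrite QP //; case: zG ACG => H _ <- /P0.
by apply: Qnull => // -[//|]; exact: zeros_notin.
Qed.

Lemma zero_in_domain (zP : forall G, AC G -> AC (cg_zero (cg_cond_neq0 G))) G :
  (domain `|` zeros_of EE) G -> (domain `|` zeros_of EE) (cg_zero (cg_cond_neq0 G)).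
Proof.
move=> [[/zP|EEG]|[H EEH <-]]; first by left; left.
  by right; exists G.
by right; exists H.
Qed.

Lemma zero_in_domain_null Q : (forall G, AC G -> Q (cg_zero (cg_cond_neq0 G)) = 0) ->
  (forall G, zeros_of EE G -> Q G = 0) ->
  forall G, (domain `|` zeros_of EE) G -> Q (cg_zero (cg_cond_neq0 G)) = 0.
Proof.
move=> Q0 Qz G [[/Q0//|EEG]|[H EEH <-]]; apply: Qz; first by exists G.
by exists H.
Qed.

Lemma lower_zero P : Cconvex_lower AC P ->
  forall G, AC G -> P (cg_zero (cg_cond_neq0 G)) = 0.
Proof. by move=> [_ P0] G /P0[]. Qed.

Lemma upper_zero P : Cconvex_upper AC P ->
  forall G, AC G -> P (cg_zero (cg_cond_neq0 G)) = 0.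
Proof.
move=> [_ P0] G ACG; have [|_] := P0 (cg_opp G); first by exists G.
by rewrite /conjugate cg_opp_zero => /eqP; rewrite oppr_eq0 => /eqP.
Qed.

Lemma approximable_lower_domain P Q G : Cconvex_lower AC P ->
  lower_extension hP EE P Q -> domain G -> approximable PP AC P Q G.
Proof.
move=> conv [QP Qstar] [ACG|EEG].
  by apply: approximable_cond_algebra => //; exact: QP.
have [C [D [hD GE]]] := EE_events EEG; rewrite GE in EEG *.
have [_ h] := EE_nontrivial EEG.
exact: approximable_lower_star (Qstar _ _ _ h EEG).
Qed.

Lemma approximable_upper_domain P Q G : Cconvex_upper AC P ->
  upper_extension hP EE P Q -> domain G ->
  approximable PP (cg_opp @` AC) (conjugate P) (conjugate Q) (cg_opp G).
Proof.
move=> conv [QP Qstar] [ACG|EEG].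
  by apply: approximable_cond_algebra_opp => //; exact: QP.
have [C [D [hD GE]]] := EE_events EEG; rewrite GE in EEG *.
have [h _] := EE_nontrivial EEG.
exact: approximable_upper_star (Qstar _ _ _ h EEG).
Qed.

Lemma Wcoherent_lower_extension P Q : Wcoherent_lower AC P ->
  lower_extension hP EE P Q -> Wcoherent_lower domain Q.
Proof.
move=> coh ext; have zAC := @cond_algebra_zero _ R _ hP.
apply: (Wcoherent_approximable hP (@cond_algebra_invariant _ _ _ hP) _ zAC coh) => G.
by apply: approximable_lower_domain ext; exact: Wcoherent_Cconvex.
Qed.

Lemma Wcoherent_upper_Cconvex P : Wcoherent_upper AC P -> Cconvex_upper AC P.
Proof. exact: Wcoherent_Cconvex (@cond_algebra_opp_zero _ R _ hP). Qed.

Lemma Wcoherent_upper_extension P Q : Wcoherent_upper AC P ->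
  upper_extension hP EE P Q -> Wcoherent_upper domain Q.
Proof.
move=> coh ext; have zAC := @cond_algebra_opp_zero _ R _ hP.
apply: (Wcoherent_approximable hP (@cond_algebra_opp_invariant _ _ _ hP) _ zAC coh).
move=> _ [G dG <-].
by apply: approximable_upper_domain ext dG; exact: Wcoherent_upper_Cconvex.
Qed.

Lemma Cconvex_lower_extension P Q : Cconvex_lower AC P ->
  lower_extension hP EE P Q -> null_on_adjoined PP EE Q ->
  Cconvex_lower (domain `|` zeros_of EE) Q.
Proof.
move=> conv ext Qnull; have zAC := @cond_algebra_zero _ R _ hP.
have P0 := lower_zero conv; have Qz := zeros_null P0 ext.1 Qnull.
split=> [|G dG]; last first.
  split; first exact: zero_in_domain.
  by apply: zero_in_domain_null dG => // H ACH; rewrite ext.1 ?P0 //; exact: zAC.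
apply: (convex_approximable hP (@cond_algebra_invariant _ _ _ hP) _ conv) => G.
(* Adjoined null events have no star to rely on; they are approximated through their outer
   conditioning event. *)
move=> [/(approximable_lower_domain conv ext)//|zG].
have QG := Qz _ zG; case: zG QG => H _ <- QG; apply: approximable_zero => // B hB sB.
have ACZ : AC (cg_zero hB) by apply: cond_algebra_cevent => //; exact: saturated0.
by split=> //; exact: P0 _ ACZ.
Qed.

Lemma Cconvex_upper_extension P Q : Cconvex_upper AC P ->
  upper_extension hP EE P Q -> null_on_adjoined PP EE Q ->
  Cconvex_upper (domain `|` zeros_of EE) Q.
Proof.
move=> conv ext Qnull; have zAC := @cond_algebra_zero _ R _ hP.
have P0 := upper_zero conv; have Qz := zeros_null P0 ext.1 Qnull.
(* A null event is its own opposite, so conjugation keeps its value 0. *)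
have conjugate0 P' B (hB : B !=set0) : P' (cg_zero hB) = 0 -> conjugate P' (cg_zero hB) = 0.
  by move=> P'0; rewrite /conjugate cg_opp_zero P'0 oppr0.
split=> [|_ [G dG <-]]; last first.
  split.
    exists (cg_zero (cg_cond_neq0 G)); last exact: cg_opp_zero.
    exact: zero_in_domain.
  apply: conjugate0.
  by apply: zero_in_domain_null dG => // H ACH; rewrite ext.1 ?P0 //; exact: zAC.
apply: (convex_approximable hP (@cond_algebra_opp_invariant _ _ _ hP) _ conv).
move=> _ [G dG <-]; case: dG => [/(approximable_upper_domain conv ext)//|zG].
have QG := Qz _ zG; case: zG QG => H _ <- QG; rewrite cg_opp_zero.
apply: approximable_zero => // [B hB sB|]; last exact: conjugate0.
have ACZ : AC (cg_zero hB) by apply: cond_algebra_cevent => //; exact: saturated0.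
split; first by exists (cg_zero hB) => //; exact: cg_opp_zero.
by apply: conjugate0; exact: P0 _ ACZ.
Qed.

End Extensions.

Theorem proposition5 (Omega : Type) (R : realType)
  (Omega_neq0 : [set: Omega] !=set0)
  (PP : set (set Omega)) (hP : is_partition PP)
  (EE : set (cgamble Omega R))
  (EE_events : EE `<=` cevents)
  (EE_nontrivial : forall (C D : set Omega) (hD : D !=set0),
     EE (cevent C hD) ->
     cevent C hD <> cevent set0 hD :> cgamble Omega R /\
     cevent C hD <> cevent D hD :> cgamble Omega R) :
  (forall P : cgamble Omega R -> R,
     (Wcoherent_lower (cond_algebra PP) P ->
        (exists Q, lower_extension hP EE P Q) /\
        (forall Q, lower_extension hP EE P Q ->
           Wcoherent_lower (cond_algebra PP `|` EE) Q)) /\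
     (Cconvex_lower (cond_algebra PP) P ->
        (exists Q, lower_extension hP EE P Q /\ null_on_adjoined PP EE Q) /\
        (forall Q, lower_extension hP EE P Q -> null_on_adjoined PP EE Q ->
           Cconvex_lower (cond_algebra PP `|` EE `|` zeros_of EE) Q))) /\
  (forall P : cgamble Omega R -> R,
     (Wcoherent_upper (cond_algebra PP) P ->
        (exists Q, upper_extension hP EE P Q) /\
        (forall Q, upper_extension hP EE P Q ->
           Wcoherent_upper (cond_algebra PP `|` EE) Q)) /\
     (Cconvex_upper (cond_algebra PP) P ->
        (exists Q, upper_extension hP EE P Q /\ null_on_adjoined PP EE Q) /\
        (forall Q, upper_extension hP EE P Q -> null_on_adjoined PP EE Q ->
           Cconvex_upper (cond_algebra PP `|` EE `|` zeros_of EE) Q))).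

Proof.
split=> P; split=> [coh|conv]; split=> [|Q].
- by have [Q [ext _]] := exists_lower_extension hP EE P; exists Q.
- exact: Wcoherent_lower_extension coh.
- exact: exists_lower_extension.
- exact: Cconvex_lower_extension conv.
- by have [Q [ext _]] := exists_upper_extension hP EE P; exists Q.
- exact: Wcoherent_upper_extension coh.
- exact: exists_upper_extension.
- exact: Cconvex_upper_extension conv.
Qed.
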